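(* Let $N \ge 2$, let $B_1 \subset \mathbb{R}^N$ be the unit ball centered at the origin, and let $1 \le p < \frac{N^2}{N-1}$. Let $\beta > 0$ satisfy $$\begin{cases} \beta < \frac{p}{N} & \text{if } 1 \le p \le N, \\ \beta < \frac{p}{N} + N - p & \text{if } N < p < \frac{N^2}{N-1}. \end{cases}$$ Then there exists a constant $C = C(\beta, p, N) > 0$ such that for every $u \in C_c^1(B_1)$, $$C \int_{B_1} \frac{|u|^p}{|x|^\beta} \, dx \le \int_{B_1} |\nabla u|^p \, dx .$$
   Context: $C_c^1(B_1)$ denotes the continuously differentiable real-valued functions with compact support in the open unit ball $B_1$. *)

(* Defs.v *)
From HB Require Import structures.
From mathcomp Require Import all_boot all_order all_algebra.
From mathcomp Require Import all_classical all_reals all_analysis.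

Set Implicit Arguments.
Unset Strict Implicit.
Unset Printing Implicit Defensive.

Import Order.TTheory GRing.Theory Num.Theory.
Import numFieldNormedType.Exports.

Local Open Scope classical_set_scope.
Local Open Scope ring_scope.

(* [R^n] is ['rV[R]_n], with the sigma-algebra generated by the coordinates;
   this is the analogue for row vectors of the library's [n.-tuple T]. *)
Definition measure_rV_display : measure_display.
Proof. exact: default_measure_display. Qed.

Section measurable_rV.
Context {R : realType} (n : nat).

Let coord (i : 'I_n) (x : 'rV[R]_n) : measurableTypeR R := x ord0 i.

Let rV_set0 : g_sigma_preimage coord set0.
Proof. exact: sigma_algebra0. Qed.

Let rV_setC A : g_sigma_preimage coord A -> g_sigma_preimage coord (~` A).
Proof. exact: sigma_algebraC. Qed.

Let rV_bigcup (F : (set 'rV[R]_n)^nat) :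
  (forall i, g_sigma_preimage coord (F i)) ->
  g_sigma_preimage coord (\bigcup_i F i).
Proof. exact: sigma_algebra_bigcup. Qed.

HB.instance Definition _ := @isMeasurable.Build measure_rV_display
  'rV[R]_n (g_sigma_preimage coord) rV_set0 rV_setC rV_bigcup.

End measurable_rV.

Section measurable_fun_rV.
Context {R : realType}.

Lemma measurable_coord n (i : 'I_n) :
  measurable_fun [set: 'rV[R]_n]
    (fun x : 'rV[R]_n => x ord0 i : measurableTypeR R).
Proof.
move=> _ Y mY; rewrite setTI; apply: sub_sigma_algebra => /=.
rewrite -bigcup_seq/=; exists i => /=; first by rewrite mem_index_enum.
by exists Y => //; rewrite setTI.
Qed.

Lemma measurable_fun_coord d (T : measurableType d) n (f : T -> 'rV[R]_n) :
  (forall i, measurable_fun [set: T] (fun t => f t ord0 i : measurableTypeR R)) ->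
  measurable_fun [set: T] f.
Proof.
move=> mf _ A mA; rewrite setTI.
pose S := [set A : set 'rV[R]_n | measurable (f @^-1` A)].
suff mS : measurable `<=` S by exact: (mS A mA).
clear A mA; apply: smallest_sub.
  split => /=.
  - by rewrite /S/= preimage_set0.
  - by move=> A mA; rewrite /S/= setTD preimage_setC; exact: measurableC.
  - by move=> F mF; rewrite /S/= preimage_bigcup; exact: bigcupT_measurable.
move=> A; rewrite -bigcup_seq/= => -[i _] [B mB <-].
rewrite /S/= setTI.
by have := mf i measurableT B mB; rewrite setTI.
Qed.

(* The identification R * R^n = R^(n+1); [(1 + n)%N] is convertible to [n.+1]. *)
Definition rV_cons n (z : measurableTypeR R * 'rV[R]_n) : 'rV[R]_n.+1 :=
  row_mx (const_mx z.1 : 'rV[R]_1) z.2.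

Definition rV_uncons n (x : 'rV[R]_n.+1) : measurableTypeR R * 'rV[R]_n :=
  (x ord0 ord0, rsubmx (x : 'rV[R]_(1 + n))).

Lemma rV_consK n : cancel (@rV_cons n) (@rV_uncons n).
Proof.
move=> [a v]; congr (_, _); last exact: row_mxKr.
rewrite /rV_cons (_ : ord0 = lshift n (ord0 : 'I_1)); last exact: val_inj.
by rewrite (row_mxEl (const_mx a : 'rV_1)) mxE.
Qed.

Lemma measurable_rV_cons n : measurable_fun setT (@rV_cons n).
Proof.
apply: measurable_fun_coord => i.
rewrite [X in measurable_fun _ X](_ : _ =
    fun z : measurableTypeR R * 'rV[R]_n => match fintype.split (i : 'I_(1 + n)) with
  inl _ => z.1 | inr j => z.2 ord0 j end).
  case: fintype.split => [_|j]; first exact: measurable_fst.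
  exact: (measurableT_comp (measurable_coord j) measurable_snd).
by apply/funext => z; rewrite mxE; case: fintype.split => // j; rewrite mxE.
Qed.

Lemma measurable_rV_uncons n : measurable_fun setT (@rV_uncons n).
Proof.
apply: measurable_fun_pair; first exact: measurable_coord.
apply: measurable_fun_coord => i.
rewrite [X in measurable_fun _ X](_ : _ =
    fun x : 'rV[R]_n.+1 => x ord0 (rshift 1 i)).
  exact: measurable_coord.
by apply/funext => x; rewrite mxE.
Qed.

End measurable_fun_rV.

Section lebesgue_rV.
Context {R : realType}.
Local Open Scope ereal_scope.

Section step.
Variables (n : nat) (mu : {sigma_finite_measure set 'rV[R]_n -> \bar R}).

Definition lebesgue_rV_step :=
  pushforward (@lebesgue_measure R \x mu) (@rV_cons R n).

Let measurable_rV_consI (A : set 'rV[R]_n.+1) :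
  measurable A -> measurable (@rV_cons R n @^-1` A).
Proof. by move=> mA; rewrite -[_ @^-1` _]setTI; exact: measurable_rV_cons. Qed.

Let step0 : lebesgue_rV_step set0 = 0.
Proof. by rewrite /lebesgue_rV_step /pushforward preimage_set0 measure0. Qed.

Let step_ge0 A : 0 <= lebesgue_rV_step A.
Proof. by apply: (@measure_ge0 _ _ _ (@lebesgue_measure R \x mu)). Qed.

Let step_sigma_additive : semi_sigma_additive lebesgue_rV_step.
Proof.
move=> F mF tF mUF; rewrite /lebesgue_rV_step /pushforward preimage_bigcup.
apply: measure_semi_sigma_additive.
- by move=> k; exact: measurable_rV_consI.
- apply/trivIsetP => /= i j _ _ ij; rewrite -preimage_setI.
  by move/trivIsetP : tF => /(_ _ _ _ _ ij) ->//; rewrite preimage_set0.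
- by rewrite -preimage_bigcup; exact: measurable_rV_consI.
Qed.

HB.instance Definition _ := isMeasure.Build _ _ _
  lebesgue_rV_step step0 step_ge0 step_sigma_additive.

Lemma lebesgue_rV_step_sigma_finite : sigma_finite setT lebesgue_rV_step.
Proof.
have /sigma_finiteP[F [TF ndF Foo]] := sigma_finiteT (@lebesgue_measure R).
have /sigma_finiteP[G [TG ndG Goo]] := sigma_finiteT mu.
exists (fun k => @rV_uncons R n @^-1` (F k `*` G k)).
  apply/seteqP; split=> // x _.
  have [i _ Fi] : (\bigcup_i F i) (rV_uncons x).1 by rewrite -TF.
  have [j _ Gj] : (\bigcup_i G i) (rV_uncons x).2 by rewrite -TG.
  exists (maxn i j) => //; split.
  - by move: Fi; exact/subsetPset/ndF/leq_maxl.
  - by move: Gj; exact/subsetPset/ndG/leq_maxr.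
move=> k; have [mF Fk] := Foo k; have [mG Gk] := Goo k; split.
  by rewrite -[_ @^-1` _]setTI; apply: measurable_rV_uncons => //;
    exact: measurableX.
rewrite /lebesgue_rV_step /pushforward -comp_preimage.
rewrite (_ : _ \o _ = id); last by apply/funext => z; exact: rV_consK.
by rewrite product_measure1E// lte_mul_pinfty// ge0_fin_numE.
Qed.

HB.instance Definition _ := Measure_isSigmaFinite.Build _ _ _
  lebesgue_rV_step lebesgue_rV_step_sigma_finite.

End step.

(* Lebesgue measure on [R^n], as the n-fold product of [lebesgue_measure] *)
Fixpoint lebesgue_rV (n : nat) : {sigma_finite_measure set 'rV[R]_n -> \bar R} :=
  if n is m.+1 then lebesgue_rV_step (lebesgue_rV m) else \d_(0%R : 'rV[R]_0).

Lemma lebesgue_rV_box (n : nat) (a b : 'I_n -> R) : (forall i, (a i <= b i)%R) ->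
  lebesgue_rV n [set x : 'rV[R]_n | forall i, x ord0 i \in `[a i, b i]] =
  (\prod_(i < n) (b i - a i)%R)%:E.
Proof.
elim: n a b => [|n IHn] a b ab.
  by rewrite big_ord0 /= diracE mem_set//= => -[].
pose B := [set v : 'rV[R]_n |
  forall i, v ord0 i \in `[a (lift ord0 i), b (lift ord0 i)]].
have mB : measurable B.
  rewrite (_ : B = \big[setI/setT]_(i < n) ((fun v : 'rV[R]_n => v ord0 i)
      @^-1` `[a (lift ord0 i), b (lift ord0 i)])).
    apply: bigsetI_measurable => i _; rewrite -[_ @^-1` _]setTI.
    exact: measurable_coord.
  by apply/seteqP; split => [v Bv|v]; rewrite -bigcap_seq/= => h i;
    [exact: Bv|apply: h; rewrite /= mem_index_enum].
rewrite /= /lebesgue_rV_step /pushforward.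
rewrite (_ : _ @^-1` _ = `[a ord0, b ord0] `*` B); last first.
  have E0 (z : measurableTypeR R * 'rV[R]_n) :
      rV_cons z ord0 ord0 = z.1 := congr1 fst (rV_consK z).
  have ES (z : measurableTypeR R * 'rV[R]_n) (j : 'I_n) :
      rV_cons z ord0 (lift ord0 j) = z.2 ord0 j.
    by have /= := congr1 (fun w : measurableTypeR R * 'rV[R]_n => w.2 ord0 j)
      (rV_consK z); rewrite mxE rshift1.
  apply/seteqP; split => z /= h.
    split=> [|i]; first by move: (h ord0); rewrite E0.
    by move: (h (lift ord0 i)); rewrite ES.
  by move=> i; case: (unliftP ord0 i) => [j|] ->;
    [rewrite ES; exact: h.2|rewrite E0; exact: h.1].
rewrite product_measure1E//= lebesgue_measure_itv/= lte_fin IHn//.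
rewrite big_ord_recl EFinM -EFinB; case: ltgtP (ab ord0) => // -> _.
by rewrite subrr.
Qed.

End lebesgue_rV.

Section C1c.
Context {R : realType} (n : nat).

(* The library's norm on ['rV[R]_n] is the sup norm, with the same topology. *)
Definition enorm (x : 'rV[R]_n) : R := Num.sqrt (\sum_(i < n) x ord0 i ^+ 2).

Definition unit_ball : set 'rV[R]_n := [set x | enorm x < 1].

Definition grad (u : 'rV[R]_n -> R) (x : 'rV[R]_n) : 'rV[R]_n :=
  \row_(i < n) 'D_(delta_mx ord0 i) u x.

Definition C1 (u : 'rV[R]_n -> R) : Prop :=
  (forall x, differentiable u x) /\ continuous (grad u).

Definition supp (u : 'rV[R]_n -> R) : set 'rV[R]_n :=
  closure [set x | u x != 0].

(* C_c^1(D): as usual, its elements are extended by 0 outside [D] *)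
Definition C1c (D : set 'rV[R]_n) (u : 'rV[R]_n -> R) : Prop :=
  [/\ C1 u, compact (supp u) & supp u `<=` D].

End C1c.
Arguments unit_ball : clear implicits.

(* Main.v *)
(** The hypotheses force beta < 1. Since |x| >= |x_0|, the weight |x|^-beta is
    bounded off the null set x_0 = 0 by |x_0|^-beta, which is integrable on
    [-1, 1]; so it is enough to prove the inequality on each line parallel to
    the first axis and to integrate over the other coordinates. On such a line
    F(-1) = 0 gives |F t| <= \int |F'|, hence the sup of |F|^p is bounded by a
    multiple of \int |F'|^p. *)
Require Import Defs.
From mathcomp Require Import all_boot all_order all_algebra.
From mathcomp Require Import all_classical all_reals all_analysis.
From mathcomp Require Import measurable_realfun ring lra.
Import Order.TTheory GRing.Theory Num.Theory.
Import numFieldNormedType.Exports.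
Local Open Scope classical_set_scope.
Local Open Scope ring_scope.

(** * Borel measurability and iterated integration on row vectors *)

(** The sigma-algebra is generated by the coordinates, not by the topology. The link is that the
    topology comes from the sup norm: an open set is a countable union of rational boxes, and each
    box is a finite intersection of coordinate preimages. *)
Lemma open_measurable_rV (R : realType) (n : nat) (A : set 'rV[R]_n) :
  open A -> measurable A.
Proof.
move=> oA.
pose box (qk : 'rV[rat]_n * nat) : set 'rV[R]_n :=
  [set x | forall i, `|x ord0 i - ratr (qk.1 ord0 i)| < qk.2.+1%:R^-1].
have mbox qk : measurable (box qk).
  rewrite (_ : box qk = \big[setI/setT]_(i < n) ((fun v : 'rV[R]_n => v ord0 i)
      @^-1` (ball (ratr (qk.1 ord0 i) : R) qk.2.+1%:R^-1))).
    apply: bigsetI_measurable => i _; rewrite -[_ @^-1` _]setTI.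
    by apply: measurable_coord => //; exact: measurable_ball.
  apply/seteqP; split => [v Bv|v]; rewrite -bigcap_seq/= => h i.
    by rewrite /ball /= distrC; exact: Bv.
  by have := h i; rewrite /ball /= distrC; apply; rewrite /= mem_index_enum.
(* Boxes not contained in [A] are replaced by [set0], so that the union runs over a whole countable
   type. *)
rewrite (_ : A = \bigcup_(qk : 'rV[rat]_n * nat)
    (if `[< box qk `<=` A >] then box qk else set0)); last first.
  apply/seteqP; split=> [x Ax|x [qk _]]; last first.
    by case: asboolP => // + bx; apply.
  have /nbhs_ballP[e /= e0 xeA] : nbhs x A by exact: open_nbhs_nbhs.
  (* Half of [e], because a point of the box is compared with [x] through the centre of the box. *)
  have [k ke] : exists k : nat, k.+1%:R^-1 < e / 2.
    exists (Num.truncn (e / 2)^-1).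
    rewrite invf_plt ?posrE ?divr_gt0//.
    by rewrite truncnS_gt.
  have qP i : exists q : rat, `|x ord0 i - ratr q| < k.+1%:R^-1.
    have [q] := @rat_in_itvoo R (x ord0 i - k.+1%:R^-1) (x ord0 i + k.+1%:R^-1)
      ltac:(rewrite ltrBlDr -addrA ltrDl addr_gt0 ?invr_gt0 ?ltr0n//).
    by rewrite in_itv/= => qi; exists q; rewrite distrC ltr_distl.
  have [q {}qP] := choice qP.
  exists (\row_i q i, k) => //.
  case: asboolP => [_ i|]; first by rewrite /= mxE.
  case=> y xy; apply: xeA; rewrite -ball_normE /ball_/=.
  rewrite [`|_|]mx_normrE; apply/bigmax_ltP; split=> // -[i j] _ /=.
  rewrite !mxE (ord1 i) (splitr e).
  have := xy j; rewrite /= mxE distrC => xyj.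
  rewrite (le_lt_trans (ler_distD (ratr (q j)) _ _))// ltrD//.
    exact: lt_trans (qP j) ke.
  exact: lt_trans xyj ke.
apply: countable_bigcupT_measurable => // qk.
by case: asboolP.
Qed.

Lemma continuous_measurable_rV (R : realType) (n : nat) (f : 'rV[R]_n -> R) :
  continuous f -> measurable_fun setT (f : 'rV[R]_n -> measurableTypeR R).
Proof.
move=> /continuousP cf; apply: (measurability _ (RGenOpens.measurableE R)).
move=> _ [_ [a [b ->] <-]]; rewrite setTI.
apply: open_measurable_rV; apply: cf; exact: interval_open.
Qed.

(** Tonelli for the pushforward that defines [lebesgue_rV n.+1]; the first coordinate is the inner
    variable, so that estimates on lines apply inside. *)
Lemma integral_rV_cons (R : realType) (n : nat) (f : 'rV[R]_n.+1 -> \bar R) :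
  measurable_fun setT f -> (forall x, 0 <= f x)%E ->
  (\int[lebesgue_rV n.+1]_x f x =
   \int[lebesgue_rV n]_v \int[lebesgue_measure]_t f (rV_cons (t, v)))%E.
Proof.
move=> mf f0.
rewrite /= ge0_integral_pushforward//; last exact: measurable_rV_cons.
rewrite preimage_setT fubini_tonelli2//.
by apply: measurableT_comp => //; exact: measurable_rV_cons.
by move=> z; exact: f0.
Qed.

Lemma enorm_ge_coord {R : realType} {n : nat} (x : 'rV[R]_n) (i : 'I_n) :
  `|x ord0 i| <= enorm x.
Proof.
rewrite -sqrtr_sqr ler_wsqrtr// (bigD1 i)//= lerDl sumr_ge0// => j _.
exact: sqr_ge0.
Qed.

Lemma measurable_enorm (R : realType) (n : nat) :
  measurable_fun setT (@enorm R n : 'rV[R]_n -> measurableTypeR R).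
Proof.
apply: (@measurableT_comp _ _ _ _ _ _ (@Num.sqrt R)).
  by apply: continuous_measurable_fun; exact: sqrt_continuous.
apply: measurable_sum => i; apply: measurable_funX; exact: measurable_coord.
Qed.

(** * One-dimensional estimates *)

(** Monotone convergence along sets avoiding the singularity at 0. On each half the primitive
    [t^(1-b) / (1-b)] gives at most [1 / (1-b)], uniformly in the cut-off. *)
Lemma integral_normr_powRN (R : realType) (b : R) : 0 < b < 1 ->
  (\int[lebesgue_measure]_(t in `[(-1)%R, 1%R]) (`|t| `^ (- b))%:E
   <= (2 / (1 - b))%:E)%E.
Proof.
move=> /andP[b0 b1].
have b1' : 0 < 1 - b by rewrite subr_gt0.
pose f (t : R) := `|t| `^ (- b).
have mf (D : set R) : measurable_fun D (EFin \o f).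
  apply/measurable_EFinP; apply: measurable_funTS.
  apply: (measurableT_comp (f := @powR R ^~ (- b))) => //.
(* With [i.+2] the cut-off is strictly below 1, as the fundamental theorem and the substitution by
   [-%R] require. *)
pose F i : set R := (`[-1, - i.+2%:R^-1] `|` `[i.+2%:R^-1, 1])%classic.
have mF i : measurable (F i) by apply: measurableU; exact: measurable_itv.
have ndF : nondecreasing_seq F.
  move=> m n mn; rewrite subsetEset.
  have nm : n.+2%:R^-1 <= m.+2%:R^-1 :> R.
    by rewrite lef_pV2 ?posrE// ler_nat !ltnS.
  apply: setUSS.
    by apply: subset_itvl; rewrite bnd_simp lerN2.
  by apply: subset_itvr; rewrite bnd_simp.
have FE : `[-1, 1]%classic `\ 0 = \bigcup_i F i.
  apply/seteqP; split => [x [+ /eqP x0]|x [i _]]; rewrite /F/= !in_itv/=.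
    move=> /andP[x1 x1']; exists (Num.truncn `|x|^-1) => //.
    have xi : (Num.truncn `|x|^-1).+2%:R^-1 <= `|x|.
      rewrite ltW// invf_plt ?posrE ?normr_gt0//.
      by rewrite (lt_trans (truncnS_gt _))// ltr_nat.
    rewrite /F /= !in_itv/= x1 x1' andbT /=.
    by have [_|_] := leP 0 x; move: xi; rewrite ler_normr lerNr => /orP[]; tauto.
  have i1 : i.+2%:R^-1 <= 1 :> R by rewrite invf_le1 ?posrE// ler1n.
  have i0 : 0 < i.+2%:R^-1 :> R by rewrite invr_gt0.
  move=> [|] /andP[x1 x2]; split.
  - by rewrite x1/= (le_trans x2)// lerNl (le_trans _ (ltW i0))// lerNl oppr0.
  - by apply/eqP; rewrite lt_eqF// (le_lt_trans x2)// oppr_lt0.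
  - by rewrite x2 andbT (le_trans _ x1)// (le_trans _ (ltW i0))// lerNl oppr0.
  - by apply/eqP; rewrite gt_eqF// (lt_le_trans i0).
rewrite -(@integral_setD1 _ _ 0); last 2 first.
  by apply: measurableD => //; exact: measurable_itv.
  exact: mf.
rewrite FE.
have f0 i x : F i x -> (0 <= (f x)%:E)%E by rewrite lee_fin powR_ge0.
have /cvg_lim <- // := ge0_nondecreasing_set_cvg_integral
  (mu := lebesgue_measure) ndF mF (fun i => mf (F i)) f0.
apply: lime_le.
  apply: ereal_nondecreasing_is_cvgn.
  apply: ge0_nondecreasing_set_nondecreasing_integral  => // i; exact: mf.
near=> i.
have i0 : 0 < i.+2%:R^-1 :> R by rewrite invr_gt0.
have i1 : i.+2%:R^-1 < 1 :> R by rewrite invf_lt1 ?posrE// ltr1n.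
have cf (x : R) : x != 0 -> {for x, continuous f}.
  move=> x0.
  apply: (@continuous_comp _ _ _ (@Num.norm _ R) (@powR R ^~ (- b))).
    exact: norm_continuous.
  apply/differentiable_continuous/derivable1_diffP.
  by apply: derivable_powR; rewrite in_itv/= andbT normr_gt0.
have dG (x : R) : 0 < x ->
    is_derive x 1 (fun t : R => (1 - b)^-1 * t `^ (1 - b)) (x `^ (- b)).
  move=> x0; have := is_deriveZ (1 - b)^-1 (is_derive1_powR (1 - b) x0).
  rewrite /GRing.scale/= mulrA mulVf ?gt_eqF// mul1r.
  by rewrite (_ : 1 - b - 1 = - b)//; ring.
have cG (x : R) : 0 < x ->
    {for x, continuous (fun t : R => (1 - b)^-1 * t `^ (1 - b))}.
  move=> x0; apply/differentiable_continuous/derivable1_diffP.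
  by have [] := dG x x0.
have If : (\int[lebesgue_measure]_(x in `[(i.+2%:R^-1)%R, 1%R]) (f x)%:E
    <= ((1 - b)^-1)%:E)%E.
  rewrite (@continuous_FTC2 _ _ (fun t : R => (1 - b)^-1 * t `^ (1 - b)))//.
  - rewrite -EFinB lee_fin powR1 mulr1 lerBlDr lerDl.
    by rewrite mulr_ge0 ?powR_ge0// invr_ge0 ltW.
  - apply: continuous_in_subspaceT => x; rewrite inE/= in_itv/= => /andP[ix _].
    by apply: cf; rewrite gt_eqF// (lt_le_trans i0).
  - split.
    + move=> x; rewrite in_itv/= => /andP[ix _].
      by have [] := dG x (lt_trans i0 ix).
    + by apply: cvg_at_right_filter; exact: cG.
    + by apply: cvg_at_left_filter; exact: cG.
  - move=> x; rewrite in_itv/= => /andP[ix _]; rewrite derive1E /f.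
    by rewrite gtr0_norm ?(lt_trans i0)//; have [] := dG x (lt_trans i0 ix).
rewrite ge0_integral_setU//; last 3 first.
- exact: mf.
- by move=> x _; rewrite lee_fin powR_ge0.
- apply/disj_setPS => x /= []; rewrite !in_itv/= => /andP[_ x1] /andP[x2 _].
  have := le_lt_trans (le_trans x2 x1) (_ : - i.+2%:R^-1 < 0).
  by rewrite oppr_lt0 => /(_ i0); rewrite ltNge ltW.
(* Since [f] is even, reflection turns the negative half into the positive one, already bounded by
   [If]. *)
rewrite (integration_by_substitution_oppr (G := f) (ltW i1)); last first.
  apply: continuous_in_subspaceT => x; rewrite inE/= in_itv/= => /andP[_ ix].
  by apply: cf; rewrite lt_eqF// (le_lt_trans ix)// oppr_lt0.
rewrite (_ : f \o -%R = f); last by apply/funext => x; rewrite /f /= normrN.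
by rewrite mulrDl mul1r EFinD leeD.
Unshelve. all: by end_near. Qed.

(** With [M = |F t|] and [I] the integral on the right, integrating [f] from -1 to [t] and splitting
    [|f|] at height [M/4] gives [M <= M/2 + (M/4)^(1-p) I]. After absorption, multiplying by
    [M^(p-1) = 4^(p-1) (M/4)^(p-1)] produces the constant. *)
Lemma powR_le_integral_derive (R : realType) (p : R) (F f : R -> R) (t : R) :
  1 <= p -> (forall x : R, is_derive x 1 F (f x)) -> continuous f ->
  F (-1) = 0 -> -1 <= t <= 1 ->
  ((`|F t| `^ p)%:E <= (2 * 4 `^ (p - 1))%:E *
    \int[lebesgue_measure]_(x in `[(-1)%R, 1%R]) (`|f x| `^ p)%:E)%E.
Proof.
move=> p1 dF cf F1 /andP[t1 t2].
have p0 : 0 < p by exact: lt_le_trans p1.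
set I := (\int[_]_(_ in _) _)%E.
have I0 : (0 <= I)%E by apply: integral_ge0 => x _; rewrite lee_fin powR_ge0.
(* The case [F t = 0] is set apart because [M] must be positive to cancel [(M/4)^(1-p)] against
   [(M/4)^(p-1)]. *)
have [Ft0|Ft0] := eqVneq (F t) 0.
  rewrite Ft0 normr0 powR0 ?gt_eqF//.
  by rewrite mule_ge0// lee_fin mulr_ge0// powR_ge0.
have {}t1 : -1 < t.
  by rewrite lt_neqAle t1 andbT; apply/eqP => t1E; rewrite -t1E F1 eqxx in Ft0.
pose M : R := `|F t|; rewrite -/M.
have M0 : 0 < M by rewrite normr_gt0.
have M40 : 0 < M / 4 by rewrite divr_gt0.
have mf (D : set R) : measurable_fun D f.
  by apply: measurable_funTS; exact: continuous_measurable_fun.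
have mnf (D : set R) : measurable_fun D (fun x => `|f x|).
  exact: measurableT_comp.
have mfp (D : set R) : measurable_fun D (fun x => `|f x| `^ p).
  exact: (measurableT_comp (f := @powR R ^~ p)).
have mEf (D : set R) : measurable_fun D (fun x => (f x)%:E).
  exact/measurable_EFinP.
have mEnf (D : set R) : measurable_fun D (fun x => `|f x|%:E).
  exact/measurable_EFinP.
have mEfp (D : set R) : measurable_fun D (fun x => (`|f x| `^ p)%:E).
  exact/measurable_EFinP.
(* Replaces Jensen's inequality; integrated over [-1, 1], the term [M / 4] leaves
   only [M / 2], which is absorbed. *)
have split_le (y : R) : 0 <= y -> y <= M / 4 + (M / 4) `^ (1 - p) * y `^ p.
  move=> y0; have [yM|My] := leP y (M / 4).
    by rewrite (le_trans yM)// lerDl mulr_ge0 ?powR_ge0.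
  apply: (@le_trans _ _ ((M / 4) `^ (1 - p) * y `^ p)); last first.
    by rewrite lerDr ltW.
  have y0' : 0 < y by exact: lt_trans My.
  (* Writing [y^p = y * y^(p-1)], it remains to see that [(M/4)^(1-p) y^(p-1) >= 1], which holds as
     [y > M/4] and [p >= 1]. *)
  rewrite -[leLHS]mulr1 -(mulr_powRB1 y0 p0) mulrCA ler_wpM2l//.
  rewrite -opprB powRN -ler_pdivrMl ?invr_gt0 ?powR_gt0// invrK mulr1.
  by apply: ge0_ler_powR; rewrite ?subr_ge0 ?nnegrE// ltW.
have MI : (M%:E <= (M / 2)%:E + ((M / 4) `^ (1 - p))%:E * I)%E.
  have -> : M%:E = `|\int[lebesgue_measure]_(x in `[(-1)%R, t]) (f x)%:E|%E.
    rewrite (@continuous_FTC2 _ _ F)//; last 3 first.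
    - exact: continuous_subspaceT.
    - have cF x : {for x, continuous F}.
        by apply/differentiable_continuous/derivable1_diffP; have [] := dF x.
      split => [x _||]; first by have [] := dF x.
        exact/cvg_at_right_filter/cF.
      exact/cvg_at_left_filter/cF.
    - by move=> x _; rewrite derive1E; have [] := dF x.
    by rewrite F1 sube0.
  apply: (le_trans (le_abse_integral _ _ _)) => //.
    exact: mEf.
  apply: (@le_trans _ _
      (\int[lebesgue_measure]_(x in `[(-1)%R, 1%R]) `|(f x)%:E|)%E).
    apply: ge0_subset_integral => //.
    - exact: mEnf.
    - by apply: subset_itvl; rewrite bnd_simp.
  apply: (@le_trans _ _ (\int[lebesgue_measure]_(x in `[(-1)%R, 1%R])
      ((M / 4)%:E + ((M / 4) `^ (1 - p))%:E * (`|f x| `^ p)%:E))%E).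
    apply: ge0_le_integral => //.
    - exact: mEnf.
    - apply: emeasurable_funD; first exact: measurable_cst.
      by apply: measurable_funeM; exact: mEfp.
    - by move=> x _; rewrite lee_fin split_le.
  rewrite ge0_integralD//; last 3 first.
  - by move=> x _; rewrite lee_fin ltW.
  - by move=> x _; rewrite lee_fin mulr_ge0 ?powR_ge0.
  - by apply: measurable_funeM; exact: mEfp.
  rewrite ge0_integralZl_EFin ?powR_ge0//; last exact: mEfp.
  have m2 : lebesgue_measure (`[-1, 1]%classic : set R) = 2%:E.
    by rewrite lebesgue_measure_itv/= lte_fin gtrN// -EFinB opprK.
  have Ic : (\int[lebesgue_measure]_(x in `[(-1)%R, 1%R]) (M / 4)%:E =
      (M / 4)%:E * lebesgue_measure (`[(-1)%R, 1%R]%classic : set R))%E.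
    exact: (integral_cst lebesgue_measure (measurable_itv _)).
  apply: leeD => //; rewrite [leLHS]Ic m2 -EFinM lee_fin; lra.
(* Absorbing [M/2] is done in the reals; an infinite [I] makes the bound trivial. *)
move: I0 MI; rewrite -/I; case: I => [r| |]//=.
  rewrite -EFinM -EFinD !lee_fin => r0 MI.
  have {MI}Mr : M <= 2 * ((M / 4) `^ (1 - p) * r) by lra.
  have M4 : 0 < (M / 4) `^ (p - 1) by exact: powR_gt0.
  rewrite -(mulr_powRB1 (ltW M0) p0).
  have -> : M `^ (p - 1) = 4 `^ (p - 1) * (M / 4) `^ (p - 1).
    by rewrite -powRM ?ltW//; congr (_ `^ _); field.
  have := ler_wpM2r (mulr_ge0 (powR_ge0 4 (p - 1)) (ltW M4)) Mr.
  move/le_trans; apply.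
  rewrite -(opprB p 1) powRN le_eqVlt; apply/orP; left; apply/eqP.
  by field; rewrite gt_eqF.
move=> _ _; rewrite gt0_muley ?leey// lte_fin mulr_gt0// powR_gt0.
Qed.

(* No pointwise bound on [G] at [t = 0]: there the junk value [0 `^ (- b) = 0]
   would force [G 0 = 0]. *)
Lemma hardy_line (R : realType) (p b : R) (F f : R -> R) (G : R -> \bar R) :
  1 <= p -> 0 < b < 1 ->
  (forall x : R, is_derive x 1 F (f x)) -> continuous f ->
  (forall t, 1 <= `|t| -> F t = 0) ->
  measurable_fun setT G -> (forall t, 0 <= G t)%E ->
  (forall t : R, t != 0%R -> G t <= (`|F t| `^ p)%:E * (`|t| `^ (- b))%:E)%E ->
  (\int[lebesgue_measure]_t G t <= (2 * 4 `^ (p - 1) * (2 / (1 - b)))%:E *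
    \int[lebesgue_measure]_t (`|f t| `^ p)%:E)%E.
Proof.
move=> p1 b01 dF cf F0 mG G0 GF.
have p0 : 0 < p by exact: lt_le_trans p1.
have mI : measurable (`[-1, 1]%classic : set R) by exact: measurable_itv.
(* Deleting the null point 0 makes the bound on [G] available on all of [D]. *)
pose D : set R := `[-1, 1]%classic `\ 0.
have mD : measurable D.
  by apply: measurableD => //; exact: measurable_set1.
have mw (E : set R) : measurable_fun E (fun t : R => (`|t| `^ (- b))%:E).
  apply/measurable_EFinP; apply: measurable_funTS.
  exact: (measurableT_comp (f := @powR R ^~ (- b))).
have mfp : measurable_fun setT (fun t : R => (`|f t| `^ p)%:E).
  apply/measurable_EFinP; apply: (measurableT_comp (f := @powR R ^~ p)) => //.
  by apply: measurableT_comp => //; exact: continuous_measurable_fun.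
pose K := ((2 * 4 `^ (p - 1))%:E *
  \int[lebesgue_measure]_(t in `[(-1)%R, 1%R]) (`|f t| `^ p)%:E)%E.
have c0 : 0 <= 2 * 4 `^ (p - 1) :> R by rewrite mulr_ge0// powR_ge0.
have K0 : (0 <= K)%E.
  by rewrite mule_ge0//; apply: integral_ge0 => t _; rewrite lee_fin powR_ge0.
(* Off [-1, 1] the function [F] vanishes, so [G] is squeezed to 0. *)
have -> : (\int[lebesgue_measure]_t G t =
    \int[lebesgue_measure]_(t in D) G t)%E.
  rewrite integral_setD1//; last exact: measurable_funTS.
  rewrite [RHS]integral_mkcond; apply: eq_integral => t _; rewrite patchE.
  case: ifPn => // /negP; rewrite inE/= in_itv/= => t1.
  have {}t1 : 1 < `|t| by rewrite ltNge ler_norml; exact/negP.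
  apply/eqP; rewrite eq_le G0 andbT (le_trans (GF _ _))//.
    by rewrite -normr_gt0 (lt_trans _ t1).
  by rewrite (F0 _ (ltW t1)) normr0 powR0 ?gt_eqF// mul0e.
(* [K] bounds [|F t|^p] uniformly in [t], so it leaves the integral and only the weight is
   integrated. *)
apply: (@le_trans _ _ (\int[lebesgue_measure]_(t in D)
    (K * (`|t| `^ (- b))%:E))%E).
  apply: ge0_le_integral => //.
  - exact: measurable_funTS.
  - by apply: measurable_funeM; exact: mw.
  - move=> t [/= tI /eqP t0]; rewrite (le_trans (GF _ t0))//.
    rewrite lee_wpmul2r ?lee_fin ?powR_ge0//.
    apply: powR_le_integral_derive => //.
    by rewrite F0// normrN1.
rewrite ge0_integralZl//; last exact: mw.
apply: (@le_trans _ _ (K * (2 / (1 - b))%:E)%E).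
  rewrite lee_wpmul2l//; have := integral_normr_powRN _ _ b01.
  by rewrite -(@integral_setD1 _ _ 0)//; exact: mw.
rewrite [X in (_ <= X * _)%E]EFinM [leRHS]muleAC lee_wpmul2r//.
  by move: b01 => /andP[_ b1]; rewrite lee_fin divr_ge0// subr_ge0 ltW.
rewrite lee_wpmul2l ?lee_fin//; exact: ge0_subset_integral.
Qed.

(** * Restriction to lines parallel to the first axis *)

(** Exhibits the line through [v] as affine with direction the first basis vector, the direction in
    which [grad] takes its first component. *)
Lemma rV_consD (R : realType) (n : nat) (s t : R) (v : 'rV[R]_n) :
  rV_cons (s + t, v) = s *: delta_mx ord0 ord0 + rV_cons (t, v).
Proof.
apply/rowP => i; rewrite /rV_cons.
have -> : (delta_mx ord0 ord0 : 'rV[R]_n.+1) = row_mx (const_mx 1 : 'rV_1) 0.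
  apply/rowP => j; rewrite !mxE eqxx/=.
  case: splitP => k jk; rewrite !mxE.
    by rewrite (ord1 k) in jk; rewrite -val_eqE /= jk.
  by rewrite -val_eqE /= jk.
rewrite !mxE; case: splitP => k _; rewrite !mxE ?mulr1//.
by rewrite mulr0 add0r.
Qed.

Lemma continuous_rV_cons (R : realType) (n : nat) (v : 'rV[R]_n) :
  continuous (fun t : R => rV_cons (t, v) : 'rV[R]_n.+1).
Proof.
rewrite (_ : (fun t : R => _) =
    fun t : R => t *: delta_mx ord0 ord0 + rV_cons (0, v)); last first.
  by apply/funext => t; rewrite -rV_consD addr0.
by move=> t; apply: cvgD; [apply: cvgZr_tmp; exact: cvg_id|exact: cvg_cst].
Qed.

(** By [rV_consD] the difference quotient of the restriction is literally that of the directional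
    derivative, so no chain rule is involved. *)
Lemma is_derive_rV_cons (R : realType) (n : nat) (u : 'rV[R]_n.+1 -> R)
    (t : R) (v : 'rV[R]_n) : differentiable u (rV_cons (t, v)) ->
  is_derive t 1 (fun s : R => u (rV_cons (s, v)))
    (grad u (rV_cons (t, v)) ord0 ord0).
Proof.
move=> du.
have E : (fun h : R => h^-1 *: (((fun s : R => u (rV_cons (s, v))) \o shift t)
      (h *: (1 : R)) - u (rV_cons (t, v)))) =
    (fun h : R => h^-1 *: ((u \o shift (rV_cons (t, v)))
      (h *: delta_mx ord0 ord0) - u (rV_cons (t, v)))).
  apply/funext => h /=; congr (_ *: (u _ - _)).
  by rewrite -rV_consD [h *: 1]mulr1.
split; first by rewrite /derivable E; exact: diff_derivable.
by rewrite mxE /derive E.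
Qed.

Lemma C1c_eq0 {R : realType} {n : nat} {D : set 'rV[R]_n} {u : 'rV[R]_n -> R}
    {x : 'rV[R]_n} : C1c D u -> ~ D x -> u x = 0.
Proof.
move=> [_ _ uD] Dx; apply: contrapT => /eqP ux; apply: Dx; apply: uD.
exact: subset_closure.
Qed.

(** The support is closed, so [u] vanishes on a whole neighbourhood of [x], not merely at [x]. *)
Lemma C1c_grad_eq0 {R : realType} {n : nat} {D : set 'rV[R]_n}
    {u : 'rV[R]_n -> R} {x : 'rV[R]_n} : C1c D u -> ~ D x -> grad u x = 0.
Proof.
move=> [_ _ uD] Dx; apply/rowP => i; rewrite !mxE.
have u0 : \near x, u x = cst 0 x.
  have : nbhs x (~` supp u).
    apply: open_nbhs_nbhs; split; last by move/uD.
    by apply: closed_openC; exact: closed_closure.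
  apply: filterS => y uy; apply: contrapT => /eqP uy0; apply: uy.
  exact: subset_closure.
by rewrite (near_eq_derive _ u0) derive_cst.
Qed.

(* At x = 0 the weight reads 0 (0 `^ beta = 0 and 0^-1 = 0), a null set. *)
Theorem theorem3 (R : realType) (N : nat) (hN : (2 <= N)%N) (p beta : R)
    (hp1 : 1 <= p) (hp2 : p < N%:R ^+ 2 / (N%:R - 1))
    (hbeta : 0 < beta)
    (hbeta1 : p <= N%:R -> beta < p / N%:R)
    (hbeta2 : N%:R < p -> beta < p / N%:R + N%:R - p) :
  exists C : R, 0 < C /\
    forall u : 'rV[R]_N -> R, C1c (unit_ball R N) u ->
      (C%:E * \int[lebesgue_rV N]_(x in unit_ball R N)
                (`|u x| `^ p / enorm x `^ beta)%:E
       <= \int[lebesgue_rV N]_(x in unit_ball R N)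
                (enorm (grad u x) `^ p)%:E)%E.
Proof.
have N1 : 1 < N%:R :> R by rewrite ltr1n.
have N0 : 0 < N%:R :> R by rewrite (lt_trans _ N1).
(* For [p > N] the bound is [p/N + N - p = 1 - (p - N)(N - 1)/N], which is below 1. *)
have b1 : beta < 1.
  have [pN|Np] := leP p N%:R.
    by rewrite (lt_le_trans (hbeta1 pN))// ler_pdivrMr// mul1r.
  rewrite (lt_le_trans (hbeta2 Np))//.
  have pE : p / N%:R * N%:R = p by rewrite divfK// gt_eqF.
  have : N%:R ^+ 2 <= p * N%:R.
    by rewrite expr2 ler_wpM2r// ltW.
  nra.
have p0 : 0 < p by exact: lt_le_trans hp1.
(* The constant of [hardy_line]; the witness for [C] is its inverse. *)
pose K : R := 2 * 4 `^ (p - 1) * (2 / (1 - beta)).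
have K0 : 0 < K by rewrite !mulr_gt0 ?invr_gt0 ?subr_gt0 ?powR_gt0.
case: N hN {hp2 hbeta1 hbeta2 N1 N0} => // n _.
exists K^-1; split=> [|u hu]; first by rewrite invr_gt0.
have [[du cgu] _ _] := hu.
have cu : continuous u by move=> x; exact: differentiable_continuous.
(* The line estimate only sees this partial derivative; it is compared with the full gradient at the
   very end. *)
pose d x := grad u x ord0 ord0.
have cd : continuous d.
  move=> x; apply: (@continuous_comp _ _ _ (grad u)
    (fun M : 'rV[R]_n.+1 => M ord0 ord0)); first exact: cgu.
  exact: coord_continuous.
have mball : measurable (unit_ball R n.+1).
  rewrite (_ : unit_ball R n.+1 = setT `&` @enorm R n.+1 @^-1` `]-oo, 1[).
    by apply: measurable_enorm => //; exact: measurable_itv.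
  by rewrite setTI; apply/seteqP; split=> x; rewrite /unit_ball/= in_itv.
pose g (x : 'rV[R]_n.+1) := (`|u x| `^ p / enorm x `^ beta)%:E.
pose h (x : 'rV[R]_n.+1) := (`|d x| `^ p)%:E.
have g0 x : (0 <= g x)%E by rewrite lee_fin divr_ge0 ?powR_ge0.
have h0 x : (0 <= h x)%E by rewrite lee_fin powR_ge0.
have mnormp (w : 'rV[R]_n.+1 -> R) : continuous w ->
    measurable_fun setT (fun x : 'rV[R]_n.+1 => `|w x| `^ p).
  move=> cw; apply: (measurableT_comp (f := @powR R ^~ p)) => //.
  by apply: measurableT_comp => //; exact: continuous_measurable_rV.
have mg : measurable_fun setT g.
  apply/measurable_EFinP; apply: measurable_funM; first exact: mnormp.
  under eq_fun do rewrite -powRN.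
  apply: (measurableT_comp (f := @powR R ^~ (- beta))) => //.
  exact: measurable_enorm.
have mh : measurable_fun setT h by apply/measurable_EFinP; exact: mnormp.
have mcons (v : 'rV[R]_n) :
    measurable_fun setT (fun t : measurableTypeR R => rV_cons (t, v)).
  apply: (@measurableT_comp _ _ _ (measurableTypeR R) _ _ (@rV_cons R n) setT
    (fun t => (t, v))); first exact: measurable_rV_cons.
  exact: pair2_measurable.
have gh : (\int[lebesgue_rV n.+1]_(x in unit_ball R n.+1) g x <=
    K%:E * \int[lebesgue_rV n.+1]_(x in unit_ball R n.+1) h x)%E.
  (* Both integrals pass to the whole space, where Tonelli applies: [h] vanishes off the ball, and
     for [g] enlarging the domain is an upper bound. *)
  have -> : (\int[lebesgue_rV n.+1]_(x in unit_ball R n.+1) h x =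
      \int[lebesgue_rV n.+1]_x h x)%E.
    rewrite integral_mkcond; apply: eq_integral => x _; rewrite patchE.
    case: ifPn => // /negP; rewrite inE => xB.
    by rewrite /h /d (C1c_grad_eq0 hu xB) mxE normr0 powR0 ?gt_eqF.
  apply: (@le_trans _ _ (\int[lebesgue_rV n.+1]_x g x)%E).
    exact: ge0_subset_integral.
  have mint k : measurable_fun setT k -> (forall x, 0 <= k x)%E ->
      measurable_fun setT (fun v : 'rV[R]_n =>
        \int[lebesgue_measure]_t k (rV_cons (t, v)))%E.
    move=> mk k0; apply: (@measurable_fun_fubini_tonelli_G _ _ _ _ _
      lebesgue_measure (fun z : measurableTypeR R * 'rV[R]_n => k (rV_cons z))) => //.
    by apply: measurableT_comp => //; exact: measurable_rV_cons.
  rewrite !integral_rV_cons// -ge0_integralZl_EFin//; last 3 first.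
  - by move=> v _; exact: integral_ge0.
  - exact: mint.
  - exact: ltW.
  apply: ge0_le_integral => //.
  - by move=> v _; exact: integral_ge0.
  - exact: mint.
  - by apply: measurable_funeM; exact: mint.
  move=> v _.
  have consE t : rV_cons (t, v) ord0 ord0 = t := congr1 fst (rV_consK (t, v)).
  apply: (hardy_line _ _ _ (fun t : R => u (rV_cons (t, v)))
    (fun t : R => d (rV_cons (t, v)))) => //.
  - exact/andP.
  - by move=> t; exact: is_derive_rV_cons.
  - move=> t; apply: continuous_comp; first exact: continuous_rV_cons.
    exact: cd.
  (* If [|t| >= 1] the point lies outside the ball, its Euclidean norm being at least [|t|]. *)
  - move=> t t1; apply: (C1c_eq0 hu); rewrite /unit_ball/= => tB.
    have := enorm_ge_coord (rV_cons (t, v)) ord0; rewrite consE.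
    by rewrite leNgt (lt_le_trans tB).
  - exact: (measurableT_comp mg (mcons v)).
  (* For [t != 0] both norms are positive, so [|t| <= enorm x] reverses under the negative power. *)
  move=> t t0; rewrite /g -EFinM lee_fin ler_wpM2l ?powR_ge0// powRN.
  rewrite lef_pV2 ?posrE ?powR_gt0 ?normr_gt0//.
    apply: ge0_ler_powR; rewrite ?nnegrE ?sqrtr_ge0//; first exact: ltW.
    by have := enorm_ge_coord (rV_cons (t, v)) ord0; rewrite consE.
  by rewrite (lt_le_trans _ (enorm_ge_coord _ ord0))// consE normr_gt0.
apply: (@le_trans _ _ (\int[lebesgue_rV n.+1]_(x in unit_ball R n.+1) h x)%E).
  rewrite -[leRHS]mul1e -(mulVf (lt0r_neq0 K0)) EFinM -muleA.
  by rewrite lee_wpmul2l// lee_fin invr_ge0 ltW.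
apply: ge0_le_integral => //.
- exact: measurable_funTS.
- apply: measurable_funTS; apply/measurable_EFinP.
  apply: (measurableT_comp (f := @powR R ^~ p)) => //.
  apply: measurableT_comp; first exact: measurable_enorm.
  apply: measurable_fun_coord => i; apply: continuous_measurable_rV => x.
  apply: (@continuous_comp _ _ _ (grad u)
    (fun M : 'rV[R]_n.+1 => M ord0 i)); first exact: cgu.
  exact: coord_continuous.
move=> x _; rewrite lee_fin; apply: ge0_ler_powR; rewrite ?nnegrE ?sqrtr_ge0//.
  exact: ltW.
exact: enorm_ge_coord.
Qed.
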